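(* For all $k,l\ge1$ we have $$F_{[k,l]}(x)=F_{k+l\ k+l-1\ \ldots\ 2\ 1}(x).$$
   Context: For a permutation $\sigma$ (in one-line notation), $I_n(3412,\sigma)$ is the set of involutions of $\{1,\ldots,n\}$ which avoid both $3412$ and $\sigma$ (no subsequence has the same relative order as the pattern), and $F_\sigma(x)=\sum_{n\ge0}|I_n(3412,\sigma)|x^n$. $[k,l]$ denotes the layered permutation $k,k-1,\ldots,1,k+l,k+l-1,\ldots,k+1$ of length $k+l$, and $k+l\ k+l-1\ \ldots\ 2\ 1$ is the decreasing permutation of length $k+l$. *)

(* Defs.v *)
From mathcomp Require Import all_boot all_fingroup ssralg ssrint.

Set Implicit Arguments.
Unset Strict Implicit.
Unset Printing Implicit Defensive.

(* A pattern is a permutation of {1, ..., m} given by its one-line notation, a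
   word of length m.  Host permutations live in 'S_n, that is, they permute
   {0, ..., n-1}; the shift by one does not affect relative order. *)
Definition contains n (p : 'S_n) (s : seq nat) : bool :=
  [exists f : {ffun 'I_(size s) -> 'I_n},
    [forall i : 'I_(size s), forall j : 'I_(size s), (i < j) ==>
       (f i < f j) && ((p (f i) < p (f j)) == (nth 0 s i < nth 0 s j))]].

Definition avoids n (p : 'S_n) (s : seq nat) : bool := ~~ contains p s.

(* The identity counts as an involution. *)
Definition involution n (p : 'S_n) : bool := [forall i, p (p i) == i].

Definition avoiding_involutions n (s t : seq nat) : {set 'S_n} :=
  [set p : 'S_n | [&& involution p, avoids p s & avoids p t]].

Definition pat3412 : seq nat := [:: 3; 4; 1; 2].

Definition decreasing m : seq nat := rev (iota 1 m).

(* k, k-1, ..., 1, k+l, k+l-1, ..., k+1 *)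
Definition layered k l : seq nat := rev (iota 1 k) ++ rev (iota k.+1 l).

(* Formal power series over the integers, as sequences of coefficients: the
   coefficient of x^n in f is f n. *)
Definition fps : Type := nat -> int.

Definition F (s : seq nat) : fps :=
  fun n => Posz #|avoiding_involutions n pat3412 s|.

(* Main.v *)
Require Import Defs.
From HB Require Import structures.
From mathcomp Require Import all_boot all_fingroup ssralg ssrint poly polydiv qpoly.
From mathcomp Require Import ring zify.
From Stdlib Require Import FunctionalExtensionality.

Set Implicit Arguments.
Unset Strict Implicit.
Unset Printing Implicit Defensive.

(** In a 3412-avoiding involution no two 2-cycles cross, so these involutions
are the noncrossing partial matchings of [0, n), that is, Motzkin trees: a
matching is empty, or a fixed point followed by a matching, or an arch over a
matching [q] followed by a matching [r].  The one-line notation of a matching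
is therefore built from the empty word by two operations, direct sum and
enclosing a word between a new maximum in front and a new minimum at the end.

Both kinds of pattern behave well under these operations.  A decreasing
subsequence of a direct sum lies in one summand, and enclosing lengthens the
longest one by exactly 2 ([decr_word]).  An occurrence of [k,l] in a direct sum
lies in one summand, unless its two decreasing runs are separated by the sum,
and enclosing creates no occurrence ([two_decr_word]).

Write D_m for the generating function of the matchings without decreasing
subsequence of length m and L for that of the matchings avoiding [k,l].  The
decomposition of trees gives
    D_0 = 0,   D_1 = 1,   (1 - x) D_{m+2} = 1 + x^2 D_m D_{m+2},
    L = D_k + D_l - (1 - x) D_k D_l + x^2 D_k D_l L             ([avoid2_rec]),
and the first line yields the addition formula
    D_{k+l} = D_k + D_l - (1 - x) D_k D_l + x^2 D_k D_l D_{k+l} ([short_add]).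
So L and D_{k+l} solve the same equation, which has a unique solution because
x^2 D_k D_l has no constant term.

The power series are handled one truncation at a time: for every commutative
ring with an element x such that x^N = 0, one sums x^(size) over a finite list
containing all trees of size less than N.  Uniqueness then comes from the
nilpotence of x, and Z[X]/(X^{n+1}) recovers the coefficients up to n. *)

(** * Patterns in words *)

Lemma subseq_catP (T : eqType) (u v w : seq T) :
  reflect (exists u1 u2, [/\ u = u1 ++ u2, subseq u1 v & subseq u2 w])
          (subseq u (v ++ w)).
Proof.
apply: (iffP idP) => [|[u1 [u2 [-> s1 s2]]]]; last exact: cat_subseq.
case/subseqP=> b szb ->; exists (mask (take (size v) b) v).
exists (mask (drop (size v) b) w); rewrite !mask_subseq; split=> //.
rewrite -mask_cat ?cat_take_drop // size_takel // szb size_cat.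
exact: leq_addr.
Qed.

Definition order_iso (u s : seq nat) : Prop :=
  size u = size s /\ forall i j, i < j -> j < size s ->
    (nth 0 u i < nth 0 u j) = (nth 0 s i < nth 0 s j).

Definition occurs (s w : seq nat) : Prop := exists2 u, subseq u w & order_iso u s.

Definition oneline n (p : 'S_n) : seq nat := [seq val (p i) | i <- enum 'I_n].

(** Occurrences as increasing maps of positions and occurrences as subsequences of
values agree: an increasing family of positions is a subsequence of the
enumeration of all positions. *)
Lemma containsP n (p : 'S_n) (s : seq nat) :
  reflect (occurs s (oneline p)) (contains p s).
Proof.
apply: (iffP existsP) => [[f /forallP Hf]|[u]].
  have mono (i j : 'I_(size s)) : i < j ->
      f i < f j /\ (p (f i) < p (f j)) = (nth 0 s i < nth 0 s j).
    by move=> lt_ij; have /forallP/(_ j)/implyP/(_ lt_ij)/andP[-> /eqP->] := Hf i.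
  exists [seq val (p i) | i <- [seq f j | j <- enum 'I_(size s)]].
    apply: map_subseq; set e := map _ _.
    have lt_tr : transitive (fun i j : 'I_n => i < j).
      by move=> j i k; apply: ltn_trans.
    have lt_irr : irreflexive (fun i j : 'I_n => i < j).
      by move=> i; apply: ltnn.
    have sorted_enum m : sorted (fun i j : 'I_m => i < j) (enum 'I_m).
      have := iota_ltn_sorted 0 m; rewrite -val_enum_ord sorted_map.
      exact: sub_sorted.
    suff -> : e = [seq i <- enum 'I_n | i \in e] by apply: filter_subseq.
    apply: (irr_sorted_eq lt_tr lt_irr).
    - apply: homo_sorted (sorted_enum _) => i j lt_ij.
      by case: (mono _ _ lt_ij).
    - exact: sorted_filter lt_tr _ _ (sorted_enum n).
    - by move=> i; rewrite mem_filter mem_enum andbT.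
  split=> [|i j lt_ij ltjs]; first by rewrite 2!size_map size_enum_ord.
  have nthE (m : 'I_(size s)) :
      nth 0 [seq val (p i) | i <- [seq f j | j <- enum 'I_(size s)]] m = p (f m).
    rewrite -map_comp (nth_map m) ?size_enum_ord //.
    by rewrite /comp nth_ord_enum.
  have [_] := mono (Ordinal (ltn_trans lt_ij ltjs)) (Ordinal ltjs) lt_ij.
  by rewrite -!nthE.
case/subseqP=> b szb ->; rewrite -map_mask.
set e := mask b _ => -[]; rewrite size_map => sze iso.
pose f (i : 'I_(size s)) := tnth (in_tuple e) (cast_ord (esym sze) i).
have nthE (g : 'I_n -> nat) (i : 'I_(size s)) : nth 0 (map g e) i = g (f i).
  have lti : i < size e by rewrite sze.
  by rewrite (nth_map (f i)) //; congr (g _); apply/esym/tnth_nth.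
exists (finfun f); apply/forallP=> i; apply/forallP=> j; apply/implyP=> lt_ij.
rewrite !ffunE -(nthE (fun i => val (p i)) i) -(nthE (fun i => val (p i)) j).
rewrite iso // eqxx andbT.
have : sorted ltn (map val e).
  rewrite map_mask val_enum_ord; apply: (subseq_sorted ltn_trans (mask_subseq _ _)).
  exact: iota_ltn_sorted.
move/(sorted_ltn_nth ltn_trans 0)/(_ i j); rewrite !inE size_map sze !ltn_ord.
by rewrite !(nthE val); apply.
Qed.

(** The weak order suffices, as the words considered have no repeated letter. *)
Definition decr m (w : seq nat) : Prop :=
  exists2 u, subseq u w & size u = m /\ pairwise geq u.

Definition two_decr k l (w : seq nat) : Prop :=
  exists u1 u2, [/\ subseq (u1 ++ u2) w, size u1 = k, size u2 = l,
    pairwise geq u1 /\ pairwise geq u2 & allrel ltn u1 u2].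

Lemma nth_rev_iota a m i : i < m -> nth 0 (rev (iota a m)) i = a + (m - i.+1).
Proof. by move=> lt_im; rewrite nth_rev size_iota // nth_iota //; lia. Qed.

Lemma pairwise_geqP m u : size u = m ->
  pairwise geq u <->
  (forall i j, i < j -> j < m -> (nth 0 u i < nth 0 u j) = false).
Proof.
move=> <-; split=> [/(pairwiseP 0) H i j lt_ij ltj|H].
  have := H i j; rewrite !inE => /(_ (ltn_trans lt_ij ltj) ltj lt_ij) /=; lia.
by apply/(pairwiseP 0) => i j; rewrite !inE => _ ltj lt_ij; have /= := H i j lt_ij ltj; lia.
Qed.

Lemma occurs_decreasing m w : occurs (decreasing m) w <-> decr m w.
Proof.
have szd : size (decreasing m) = m by rewrite size_rev size_iota.
have nthd i j : i < j -> j < m ->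
    (nth 0 (decreasing m) i < nth 0 (decreasing m) j) = false.
  by move=> *; rewrite !nth_rev_iota; lia.
split=> -[u su].
  case; rewrite szd => szu iso; exists u => //; split=> //.
  by apply/(pairwise_geqP szu) => i j lt_ij ltj; rewrite iso // nthd.
case=> szu /(pairwise_geqP szu) geu; exists u => //; split; rewrite szd //.
by move=> i j lt_ij ltj; rewrite geu // nthd.
Qed.

Lemma occurs_layered k l w : occurs (layered k l) w <-> two_decr k l w.
Proof.
have szd : size (layered k l) = k + l by rewrite size_cat !size_rev !size_iota.
have nthd i j : i < j -> j < k + l ->
    (nth 0 (layered k l) i < nth 0 (layered k l) j) = (i < k <= j).
  move=> lt_ij ltj; rewrite !nth_cat size_rev size_iota.
  by case: ifP => ?; case: ifP => ?; rewrite !nth_rev_iota; lia.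
split.
  case=> u su []; rewrite szd => szu iso.
  have szk : size (take k u) = k by rewrite size_takel // szu leq_addr.
  have szl : size (drop k u) = l by rewrite size_drop szu addKn.
  exists (take k u), (drop k u); rewrite cat_take_drop; split=> //.
    split; [apply/(pairwise_geqP szk)|apply/(pairwise_geqP szl)] => i j lt_ij ltj.
      by rewrite !nth_take ?iso ?nthd; lia.
    by rewrite !nth_drop ?iso ?nthd; lia.
  apply/allrelP=> x y /(nthP 0)[i]; rewrite szk => lti <-.
  case/(nthP 0)=> j; rewrite szl => ltj <- /=.
  by rewrite nth_take // nth_drop iso ?nthd; lia.
case=> u1 [u2 [su sz1 sz2 [/(pairwise_geqP sz1) ge1 /(pairwise_geqP sz2) ge2] lt12]].
exists (u1 ++ u2) => //; split; first by rewrite szd size_cat sz1 sz2.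
rewrite szd => i j lt_ij ltj; rewrite nthd // !nth_cat sz1.
case: (ltnP i k) => lti; case: (ltnP j k) => ltj' /=.
- by rewrite ge1 //; lia.
- by apply: (allrelP lt12); apply: mem_nth; lia.
- lia.
- by rewrite ge2 //; lia.
Qed.

(** An order isomorphism records only whether an earlier letter is smaller than a
later one, whence the weak inequality. *)
Lemma occurs_3412 w : occurs pat3412 w <->
  exists v1 v2 v3 v4, [/\ subseq [:: v1; v2; v3; v4] w, v3 < v4, v4 <= v1 & v1 < v2].
Proof.
split.
  case=> -[|v1 [|v2 [|v3 [|v4 [|? ?]]]]] su [//= _ iso].
  exists v1, v2, v3, v4; split=> //.
  - by rewrite (iso 2 3).
  - by rewrite leqNgt (iso 0 3).
  - by rewrite (iso 0 1).
case=> v1 [v2 [v3 [v4 [su lt34 lt41 lt12]]]]; exists [:: v1; v2; v3; v4] => //.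
split=> // -[|[|[|[|i]]]] [|[|[|[|j]]]] //= _ _; lia.
Qed.

(** * Patterns in direct sums and under an arch *)

Lemma decr_le m m' w : m' <= m -> decr m w -> decr m' w.
Proof.
move=> le_m [u su [szu geu]]; exists (take m' u).
  exact: subseq_trans (take_subseq _ _) su.
rewrite size_takel ?szu //; split=> //.
exact: subseq_pairwise (take_subseq _ _) geu.
Qed.

(** A decreasing run cannot pass from a word to one with larger letters. *)
Lemma geq_cat_nil x y v w : allrel ltn v w -> subseq x v -> subseq y w ->
  pairwise geq (x ++ y) -> x = [::] \/ y = [::].
Proof.
case: x => [|i x]; case: y => [|j y] lt_vw sx sy; auto.
rewrite pairwise_cat => /and3P[/allrelP ge_xy _ _].
have := allrelP lt_vw i j (mem_subseq sx (mem_head _ _)) (mem_subseq sy (mem_head _ _)).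
by have /= := ge_xy i j (mem_head _ _) (mem_head _ _); lia.
Qed.

Lemma decr1 m i : decr m [:: i] <-> m <= 1.
Proof.
split=> [[u /size_subseq + [<- _]] //|].
by move/decr_le; apply; exists [:: i].
Qed.

Lemma decr_cat m v w : allrel ltn v w -> decr m (v ++ w) <-> decr m v \/ decr m w.
Proof.
move=> lt_vw; split=> [[u /subseq_catP[x [y [-> sx sy]]] [sz ge]]|].
  have [eq0|eq0] := geq_cat_nil lt_vw sx sy ge; [right|left]; move: sz ge.
    by rewrite eq0 /=; exists y.
  by rewrite eq0 cats0; exists x.
case=> -[u su uP]; exists u => //; apply: subseq_trans su _.
  exact: prefix_subseq.
exact: suffix_subseq.
Qed.

Lemma cat_eq_cat (T : Type) (x y v w : seq T) : x ++ y = v ++ w ->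
  (exists r, x = v ++ r /\ w = r ++ y) \/ (exists r, v = x ++ r /\ y = r ++ w).
Proof.
elim: x v => [|i x IHx] [|j v] /= eq_cat.
- by left; exists [::].
- by right; exists (j :: v).
- by left; exists (i :: x).
by case: eq_cat => -> /IHx[] [r [-> ->]]; [left|right]; exists r.
Qed.

(** Each of the two decreasing runs stays in one summand, and the first run cannot
lie to the right of the second. *)
Lemma two_decr_cat k l v w : allrel ltn v w ->
  two_decr k l (v ++ w) <->
  two_decr k l v \/ two_decr k l w \/ decr k v /\ decr l w.
Proof.
move=> lt_vw; split.
  case=> u1 [u2 [/subseq_catP[x [y [eq_u sx sy]]] sz1 sz2 [ge1 ge2] lt12]].
  case: (cat_eq_cat eq_u) => -[r [Eu Ev]].
    have sr : subseq r w.
      by apply: subseq_trans sy; rewrite Ev prefix_subseq.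
    have := ge1; rewrite {1}Eu => /(geq_cat_nil lt_vw sx sr)[x0|r0].
      by right; left; exists u1, u2; rewrite eq_u x0.
    right; right; rewrite r0 cats0 in Eu; rewrite r0 in Ev.
    by split; [exists u1; rewrite // Eu|exists u2; rewrite // -[u2]Ev].
  have sr : subseq r v.
    by apply: subseq_trans sx; rewrite Eu suffix_subseq.
  have := ge2; rewrite {1}Ev => /(geq_cat_nil lt_vw sr sy)[r0|y0].
    right; right; rewrite r0 cats0 in Eu; rewrite r0 in Ev.
    by split; [exists u1; rewrite // -Eu|exists u2; rewrite // [u2]Ev].
  by left; exists u1, u2; rewrite eq_u y0 cats0.
case=> [[u1 [u2 [su *]]]|[[u1 [u2 [su *]]]|[[u1 s1 [sz1 ge1]] [u2 s2 [sz2 ge2]]]]].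
- by exists u1, u2; split=> //; apply: subseq_trans su (prefix_subseq _ _).
- by exists u1, u2; split=> //; apply: subseq_trans su (suffix_subseq _ _).
exists u1, u2; split=> //; first exact: cat_subseq.
by apply/allrelP=> i j /(mem_subseq s1) + /(mem_subseq s2); apply: (allrelP lt_vw).
Qed.

Definition avoids3412 (w : seq nat) : Prop := ~ occurs pat3412 w.

(** The pattern 3412 is not itself a direct sum: its last letter is smaller than
its first, so an occurrence has both ends in the same summand. *)
Lemma avoids3412_cat v w : allrel ltn v w ->
  avoids3412 v -> avoids3412 w -> avoids3412 (v ++ w).
Proof.
move=> lt_vw av aw /occurs_3412[v1 [v2 [v3 [v4 [su lt34 le41 lt12]]]]].
case/subseq_catP: su => [x [y [eq_u sx sy]]].
have [x0|] := eqVneq x [::].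
  by apply: aw; apply/occurs_3412; exists v1, v2, v3, v4; rewrite eq_u x0.
have [y0|] := eqVneq y [::].
  by move=> _; apply: av; apply/occurs_3412; exists v1, v2, v3, v4; rewrite eq_u y0 cats0.
case: (lastP y) eq_u sy => // y' j eq_u sy _; case: x eq_u sx => // i x.
rewrite -rcons_cat -[[:: _; _; _; _]]/(rcons [:: v1; v2; v3] v4).
case/rcons_inj=> Ei _ Ej sx _.
have j_w : j \in w by apply: (mem_subseq sy); rewrite mem_rcons mem_head.
have := allrelP lt_vw i j (mem_subseq sx (mem_head _ _)) j_w.
by move=> /=; lia.
Qed.

(** The word [b :: rcons w a] is [w] under an arch: its first letter is the maximum
and its last letter the minimum. *)
Section Nest.

Variables (a b : nat) (w : seq nat).
Hypothesis w_ab : all (fun i => a < i < b) w.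
Hypothesis lt_ab : a < b.

Local Notation nest := (b :: rcons w a).

Lemma nest_ge i : i \in nest -> a <= i <= b.
Proof.
rewrite inE mem_rcons inE => /or3P[/eqP->|/eqP->|/(allP w_ab)/andP[? ?]].
- by rewrite leqnn ltnW.
- by rewrite leqnn ltnW.
by apply/andP; split; apply: ltnW.
Qed.

(** The tool for patterns whose first letter is not their maximum and whose last
letter is not their minimum: such an occurrence uses neither end of the arch. *)
Lemma subseq_nest x u y : x != b -> y != a ->
  subseq (x :: rcons u y) nest -> subseq (x :: rcons u y) w.
Proof.
move=> neq_xb neq_ya; rewrite /= (negPf neq_xb) -rcons_cons -subseq_rev !rev_rcons.
by rewrite /= (negPf neq_ya) -rev_rcons subseq_rev.
Qed.

Lemma decr_nest m : decr m nest <-> decr (m - 2) w.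
Proof.
split=> [[u su [szu geu]]|[u su [szu geu]]].
  move: su; rewrite -cat1s -cats1 => /subseq_catP[x [u' [Eu sx]]].
  case/subseq_catP=> y [z [Eu' sy sz]]; rewrite {}Eu' in Eu.
  apply: (@decr_le (size y)).
    have := size_subseq sx; have := size_subseq sz.
    by rewrite -szu Eu !size_cat /=; lia.
  exists y => //; split=> //; apply: subseq_pairwise geu; rewrite Eu.
  by apply: subseq_trans (suffix_subseq _ _); apply: prefix_subseq.
apply: (@decr_le (size u).+2); first by rewrite szu; lia.
exists (b :: rcons u a); rewrite /= ?size_rcons; last split=> //.
  by rewrite eqxx -!cats1 cat_subseq.
have u_ab i : i \in u -> a < i < b by move/(mem_subseq su)/(allP w_ab).
rewrite -cats1 pairwise_cat geu allrel1r all_cat /= !andbT ltnW // andbT.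
by apply/andP; split; apply/allP=> i /u_ab /=; lia.
Qed.

Lemma two_decr_nest k l : 0 < k -> 0 < l -> two_decr k l nest <-> two_decr k l w.
Proof.
move=> k_gt0 l_gt0; split; case=> u1 [u2 [su sz1 sz2 ge12 lt12]]; exists u1, u2.
  split=> //; case: u1 sz1 lt12 su {ge12} => [|x u1]; first by move=> /=; lia.
  case/lastP: u2 sz2 => [|u2 y _ _ lt12]; first by move=> /=; lia.
  have lt_xy : x < y by apply: (allrelP lt12); rewrite ?mem_rcons mem_head.
  rewrite cat_cons -rcons_cat => su; apply: subseq_nest => //.
    have : y \in nest by apply: (mem_subseq su); rewrite inE mem_rcons mem_head orbT.
    by move/nest_ge; lia.
  have : x \in nest by apply: (mem_subseq su); rewrite mem_head.
  by move/nest_ge; lia.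
split=> //; apply: subseq_trans su _; rewrite -cats1 -cat1s.
by apply: subseq_trans (suffix_subseq _ _); apply: prefix_subseq.
Qed.

Lemma avoids3412_nest : avoids3412 w -> avoids3412 nest.
Proof.
move=> aw /occurs_3412[v1 [v2 [v3 [v4 [su lt34 le41 lt12]]]]].
apply: aw; apply/occurs_3412; exists v1, v2, v3, v4; split=> //.
have in_nest i : i \in [:: v1; v2; v3; v4] -> a <= i <= b.
  by move/(mem_subseq su)/nest_ge.
apply: (@subseq_nest v1 [:: v2; v3] v4) su.
  by have := in_nest v2; rewrite !inE eqxx orbT => /(_ isT); lia.
by have := in_nest v3; rewrite !inE eqxx !orbT => /(_ isT); lia.
Qed.

End Nest.

(** * Motzkin trees *)

(** Noncrossing partial matchings of an interval, read from its left end, which is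
either fixed or matched with the point where its arch closes. *)
Inductive tree := Leaf | Fix of tree | Arch of tree & tree.

Fixpoint points t :=
  match t with
  | Leaf => 0
  | Fix r => (points r).+1
  | Arch q r => (points q + points r).+2
  end.

(** One-line notation of the matching [t] of the interval that starts at [a].
Absolute coordinates make subwords values of one and the same function. *)
Fixpoint word a t : seq nat :=
  match t with
  | Leaf => [::]
  | Fix r => [:: a] ++ word a.+1 r
  | Arch q r => ((a + points q).+1 :: rcons (word a.+1 q) a) ++ word (a + points q).+2 r
  end.

Lemma size_word a t : size (word a t) = points t.
Proof.
elim: t a => //= [r IHr|q IHq r IHr] a; first by rewrite IHr.
by rewrite size_cat size_rcons IHq IHr addSn.
Qed.

Lemma iota_arch a m n :
  iota a (m + n).+2 = a :: iota a.+1 m ++ (a + m).+1 :: iota (a + m).+2 n.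
Proof. by rewrite -addnS /= iotaD /= addSn. Qed.

Lemma perm_word a t : perm_eq (word a t) (iota a (points t)).
Proof.
elim: t a => //= [r IHr|q IHq r IHr] a; first by rewrite perm_cons.
rewrite -/(iota a (points q + points r).+2) iota_arch -cat_cons -cat_rcons -cat_cons.
rewrite perm_cat // -rcons_cons perm_rcons perm_cons perm_sym perm_rcons perm_cons perm_sym.
exact: IHq.
Qed.

Lemma mem_word a t i : (i \in word a t) = (a <= i < a + points t).
Proof. by rewrite (perm_mem (perm_word a t)) mem_iota. Qed.

Lemma word_inj a : injective (word a).
Proof.
move=> t; elim: t a => [|r IHr|q IHq r IHr] a [|r'|q' r'] //= [].
- by move/IHr->.
- by lia.
- by lia.
move/addnI => eq_sz; rewrite eq_sz.
by move/eqP; rewrite eqseq_cat ?size_rcons ?size_word ?eq_sz // eqseq_rcons eqxx andbT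
  => /andP[/eqP/IHq-> /eqP/IHr->].
Qed.

HB.instance Definition _ := Equality.copy tree (inj_type (@word_inj 0)).

(** The length of a longest decreasing subsequence of [word a t]. *)
Fixpoint depth t :=
  match t with
  | Leaf => 0
  | Fix r => maxn 1 (depth r)
  | Arch q r => maxn (depth q).+2 (depth r)
  end.

Fixpoint two_layers k l t :=
  match t with
  | Leaf => false
  | Fix r => two_layers k l r || ((k <= 1) && (l <= depth r))
  | Arch q r => [|| two_layers k l q, two_layers k l r
                  | (k <= (depth q).+2) && (l <= depth r)]
  end.

Lemma word_Fix_ltn a r : allrel ltn [:: a] (word a.+1 r).
Proof. by rewrite allrel1l; apply/allP=> i; rewrite mem_word /=; lia. Qed.

Lemma word_Arch_bounds a q : all (fun i => a < i < (a + points q).+1) (word a.+1 q).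
Proof. by apply/allP=> i; rewrite mem_word; lia. Qed.

Lemma word_Arch_ltn a q r :
  allrel ltn ((a + points q).+1 :: rcons (word a.+1 q) a) (word (a + points q).+2 r).
Proof.
apply/allrelP=> i j; rewrite inE mem_rcons inE !mem_word => /or3P[/eqP->|/eqP->|] /=; lia.
Qed.

Lemma decr_word m a t : decr m (word a t) <-> m <= depth t.
Proof.
elim: t m a => [|r IHr|q IHq r IHr] m a /=.
- split=> [[u]|]; first by rewrite subseq0 => /eqP-> [<-].
  by rewrite leqn0 => /eqP->; exists [::].
- have -> : a :: word a.+1 r = [:: a] ++ word a.+1 r by [].
  rewrite decr_cat ?word_Fix_ltn // decr1 IHr leq_max.
  by split=> [[->|->]|/orP[]]; rewrite ?orbT; auto.
rewrite -cat_cons decr_cat ?word_Arch_ltn // IHr leq_max.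
rewrite decr_nest ?word_Arch_bounds //; last by lia.
rewrite IHq leq_subLR add2n.
by split=> [[->|->]|/orP[]]; rewrite ?orbT; auto.
Qed.

Lemma two_decr_word k l a t : 0 < k -> 0 < l ->
  two_decr k l (word a t) <-> two_layers k l t.
Proof.
move=> k_gt0 l_gt0.
elim: t a => [|r IHr|q IHq r IHr] a /=.
- split=> // -[u1 [u2 []]]; rewrite subseq0.
  by case: u1 => [|? ?] //= _ k0; rewrite -k0 in k_gt0.
- have -> : a :: word a.+1 r = [:: a] ++ word a.+1 r by [].
  rewrite two_decr_cat ?word_Fix_ltn // decr1 IHr decr_word.
  split=> [[|[->|[-> ->]]]|/orP[|/andP]]; rewrite ?orbT; auto.
  by case=> -[|? ?] [[|? ?] [/size_subseq]]; rewrite ?size_cat /=; lia.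
rewrite -cat_cons two_decr_cat ?word_Arch_ltn // IHr decr_word.
rewrite decr_nest ?two_decr_nest ?word_Arch_bounds //; try lia.
rewrite IHq decr_word leq_subLR add2n.
by split=> [[->|[->|[-> ->]]]|/or3P[||/andP]]; rewrite ?orbT; auto.
Qed.

Lemma avoids3412_word a t : avoids3412 (word a t).
Proof.
elim: t a => [|r IHr|q IHq r IHr] a.
- by case/occurs_3412=> v1 [v2 [v3 [v4 []]]].
- apply: avoids3412_cat; rewrite ?word_Fix_ltn //.
  by case/occurs_3412=> v1 [v2 [v3 [v4 [/size_subseq]]]].
apply: avoids3412_cat; rewrite ?word_Arch_ltn //.
by apply: avoids3412_nest; rewrite ?word_Arch_bounds //; lia.
Qed.

(** * Noncrossing involutions and Motzkin trees *)

Lemma word_involutive (f : nat -> nat) a t :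
  map f (iota a (points t)) = word a t ->
  forall i, a <= i < a + points t -> f (f i) = i.
Proof.
elim: t a => [|r IHr|q IHq r IHr] a; first by move=> _ i /=; lia.
  case=> fa /IHr fr i; rewrite leq_eqVlt => /andP[/orP[/eqP<- _|ai lti]].
    by rewrite !fa.
  by apply: fr; rewrite ai addSnnS.
rewrite [points _]/= iota_arch map_cons map_cat map_cons /= => -[fa].
rewrite cat_rcons => /eqP; rewrite eqseq_cat ?size_map ?size_iota ?size_word //.
case/andP=> /eqP/IHq fq /eqP[fb /IHr fr] i /andP[le_ai lti].
have [->|neq_ia] := eqVneq i a; first by rewrite fa fb.
have [->|neq_ib] := eqVneq i (a + points q).+1; first by rewrite fb fa.
by case: (leqP i (a + points q)) => ?; [apply: fq|apply: fr]; lia.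
Qed.

(** The arch from the left end [a] of the interval to [f a] cuts the interval into
the part inside, which is stable under [f] because no arch crosses this one,
and the part to its right, which is then stable as well. *)
Lemma word_of_noncrossing (f : nat -> nat) : involutive f ->
  (forall i j, i < j -> j < f i -> f i < f j -> False) ->
  forall n a, (forall i, a <= i < a + n -> a <= f i < a + n) ->
  exists2 t, points t = n & map f (iota a n) = word a t.
Proof.
move=> fK ncf n; elim/ltn_ind: n => -[|n] IHn a closed; first by exists Leaf.
have [fa|neq_fa] := eqVneq (f a) a.
  have [i i_in|r szr wr] := IHn n (leqnn _) a.+1.
    have neq_fi : f i <> a by move=> fi; have := fK i; rewrite fi fa; lia.
    by have := closed i; lia.
  by exists (Fix r); rewrite /= ?szr // fa wr.
have lt_afa : a < f a < a + n.+1 by have := closed a; lia.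
pose m := f a - a.+1.
have Efa : f a = (a + m).+1 by rewrite /m; lia.
have ffa : f (a + m).+1 = a by rewrite -Efa fK.
have inside i : a < i <= a + m -> a < f i <= a + m.
  move=> i_in; have := closed i; have := ncf a i; rewrite Efa.
  have : f i <> a by move=> fi; have := fK i; rewrite fi; lia.
  have : f i <> (a + m).+1 by move=> fi; have := fK i; rewrite fi; lia.
  by case: (ltnP (a + m).+1 (f i)) => ? ? ? nc; [case: nc; lia|lia].
have [||q szq wq] := IHn m _ a.+1; first by rewrite /m; lia.
  by move=> i; have := inside i; lia.
have [||r szr wr] := IHn (n.-1 - m) _ (a + m).+2; first by lia.
  move=> i i_in; have := closed i.
  have : f i <> a by move=> fi; have := fK i; rewrite fi; lia.
  have : f i <> (a + m).+1 by move=> fi; have := fK i; rewrite fi; lia.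
  have : ~ (a < f i <= a + m) by move/inside; rewrite fK; lia.
  by rewrite /m; lia.
exists (Arch q r); first by rewrite /= szq szr /m; lia.
have -> : n.+1 = (m + (n.-1 - m)).+2 by rewrite /m; lia.
by rewrite iota_arch map_cons map_cat map_cons wq wr Efa ffa /= szq cat_rcons.
Qed.

Lemma oneline_iota n (p : 'S_n) (f : nat -> nat) :
  (forall i : 'I_n, f i = p i) -> oneline p = map f (iota 0 n).
Proof. by move=> fp; rewrite -val_enum_ord -map_comp; apply: eq_map => i /=. Qed.

Lemma oneline_inj n : injective (@oneline n).
Proof.
by move=> p p' /eq_in_map E; apply/permP=> i; apply/val_inj/E; rewrite mem_enum.
Qed.

(** Permutations of [0, n) as functions on [nat], so that one function serves all
subintervals in the recursion. *)
Definition extend n (p : 'S_n) i : nat := oapp (fun j => val (p j)) i (insub i).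

Lemma extendE n (p : 'S_n) (i : 'I_n) : extend p i = p i.
Proof. by rewrite /extend valK. Qed.

Lemma extend_ge n (p : 'S_n) i : n <= i -> extend p i = i.
Proof. by move=> le_ni; rewrite /extend insubF // ltnNge le_ni. Qed.

(** Crossing arches [i < j < p i < p j] are an occurrence of 3412, with values
[p i, p j, i, j] at these four positions. *)
Lemma involution_word n (p : 'S_n) : involution p -> avoids p pat3412 ->
  exists2 t, points t = n & oneline p = word 0 t.
Proof.
move=> /forallP pK avp.
have ext_lt i : i < n -> extend p i < n.
  by move=> lti; rewrite (extendE p (Ordinal lti)).
have extK : involutive (extend p).
  move=> i; case: (ltnP i n) => [lti|le_ni]; last by rewrite !extend_ge.
  by rewrite (extendE p (Ordinal lti)) extendE (eqP (pK _)).
rewrite (oneline_iota (extendE p)).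
apply: word_of_noncrossing => // i j lt_ij lt_ji lt_ij'.
have ltfj : extend p j < n.
  case: (ltnP j n) => [/ext_lt//|le_nj].
  by rewrite (extend_ge _ le_nj) in lt_ij'; lia.
case/negP: avp; apply/containsP/occurs_3412.
exists (extend p i), (extend p j), i, j; split=> //; last exact: ltnW.
rewrite (oneline_iota (extendE p)).
have -> : [:: extend p i; extend p j; i; j] =
    map (extend p) [:: i; j; extend p i; extend p j].
  by rewrite /= !extK.
apply: map_subseq.
have -> : [:: i; j; extend p i; extend p j] =
   [seq k <- iota 0 n | k \in [:: i; j; extend p i; extend p j]].
  apply: (irr_sorted_eq ltn_trans ltnn) => [||k].
  - by rewrite /= lt_ij lt_ji lt_ij'.
  - exact/(sorted_filter ltn_trans)/iota_ltn_sorted.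
  by rewrite mem_filter mem_iota /= !inE; case: eqP; case: eqP; case: eqP; case: eqP; lia.
exact: filter_subseq.
Qed.

Lemma word_perm t : exists2 p : 'S_(points t), oneline p = word 0 t & involution p.
Proof.
have lt_nth (i : 'I_(points t)) : nth 0 (word 0 t) i < points t.
  by have := mem_nth 0 (s := word 0 t) (n := i); rewrite size_word mem_word; apply.
pose f i := Ordinal (lt_nth i).
have f_inj : injective f.
  move=> i j /(congr1 val) /= /eqP.
  rewrite nth_uniq ?size_word // ?(perm_uniq (perm_word 0 t)) ?iota_uniq //.
  by move/eqP/val_inj.
pose p := perm f_inj.
have op : oneline p = map (nth 0 (word 0 t)) (iota 0 (points t)).
  by apply: oneline_iota => i; rewrite permE.
exists p; first by rewrite op -(size_word 0 t) map_nth_iota0 // take_size.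
apply/forallP=> i; apply/eqP/val_inj; rewrite !permE /=.
apply: (@word_involutive (nth 0 (word 0 t)) 0 t); last exact: ltn_ord.
by rewrite -(size_word 0 t) map_nth_iota0 // take_size.
Qed.

(** * Enumeration of trees *)

(** Trees of height at most [h].  Bounding the height rather than the size lets the
list for [h.+1] be a full product, hence gives products of generating
functions. *)
Fixpoint trees h : seq tree :=
  if h is h'.+1 then
    Leaf :: map Fix (trees h') ++ [seq Arch q r | q <- trees h', r <- trees h']
  else [:: Leaf].

Lemma mem_trees h t : points t <= h -> t \in trees h.
Proof.
elim: h t => [|h IHh] [|r|q r] //= le_th; rewrite inE mem_cat /=.
  by rewrite map_f ?IHh.
by rewrite allpairs_f ?orbT ?IHh //; lia.
Qed.

Lemma trees_uniq h : uniq (trees h).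
Proof.
elim: h => //= h IHh; rewrite mem_cat negb_or cat_uniq -andbA; apply/and5P; split.
- by apply/mapP=> -[].
- by apply/allpairsP=> -[[q r] []].
- by rewrite map_inj_uniq // => r r' [].
- by apply/hasPn=> t /allpairsP[[q r] [_ _ ->]]; apply/mapP=> -[].
by apply: allpairs_uniq => // -[q r] [q' r'] _ _ [-> ->].
Qed.

(** Trees with [n] points enumerate the 3412-avoiding involutions, so counting those
that avoid [s] only requires reading off from the tree whether [s] occurs. *)
Lemma card_avoiding_involutions n s (P : pred tree) h : n <= h ->
  (forall t, reflect (occurs s (word 0 t)) (~~ P t)) ->
  #|avoiding_involutions n pat3412 s|
    = count (fun t => (points t == n) && P t) (trees h).
Proof.
move=> le_nh PP; rewrite -size_filter; set l := filter _ _.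
pose g t : 'S_n := odflt 1%g [pick p : 'S_n | oneline p == word 0 t].
have gP t : t \in l -> oneline (g t) = word 0 t /\ involution (g t).
  rewrite mem_filter => /andP[/andP[/eqP szt _] _].
  have [p op ip] : exists2 p : 'S_n, oneline p = word 0 t & involution p.
    by case: n / szt {l g le_nh}; apply: word_perm.
  rewrite /g; case: pickP => [p' /eqP op'|/(_ p)]; last by rewrite op eqxx.
  by have -> : p' = p by apply: oneline_inj; rewrite op op'.
have g_inj : {in l &, injective g}.
  move=> t t' /gP[gt _] /gP[gt' _] eq_g.
  by apply: (@word_inj 0); rewrite -gt -gt' eq_g.
rewrite -(size_map g) -(card_uniqP _); last first.
  by rewrite map_inj_in_uniq // filter_uniq ?trees_uniq.
apply: eq_card => p; rewrite inE.
have avP t (p' : 'S_n) : oneline p' = word 0 t ->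
    avoids p' pat3412 && avoids p' s = P t.
  move=> op; rewrite /avoids.
  have -> : contains p' pat3412 = false.
    by apply/negbTE/negP=> /containsP; rewrite op; apply: avoids3412_word.
  have -> : contains p' s = ~~ P t.
    by apply: (sameP (containsP _ _)); rewrite op.
  by rewrite negbK.
apply/and3P/mapP=> [[ip av3412 avs]|[t tl ->]].
  have [t szt op] := involution_word ip av3412.
  have tl : t \in l.
    rewrite mem_filter szt eqxx -(avP t p) // av3412 avs /=.
    by apply: mem_trees; rewrite szt.
  by exists t => //; apply: oneline_inj; rewrite op; case: (gP t tl).
have [op ip] := gP t tl; have := avP t (g t) op.
have -> : P t by move: tl; rewrite mem_filter => /andP[/andP[]].
by case/andP.
Qed.

(** * Truncated generating functions *)

Section GeneratingFunctions.

Import GRing.Theory.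
Local Open Scope ring_scope.

Variables (R : comNzRingType) (x : R) (N : nat).
Hypothesis xN : x ^+ N = 0.

Lemma expr_nilp n : (N <= n)%N -> x ^+ n = 0.
Proof. by move=> le_Nn; rewrite -(subnK le_Nn) exprD xN mulr0. Qed.

Definition gf (P : pred tree) : R := \sum_(t <- trees N) (P t)%:R * x ^+ points t.

(** The additional trees have at least [N] points, so their weight vanishes. *)
Lemma gf_succ (P : pred tree) : \sum_(t <- trees N.+1) (P t)%:R * x ^+ points t = gf P.
Proof.
have small h : \sum_(t <- trees h) (P t)%:R * x ^+ points t
    = \sum_(t <- trees h | (points t < N)%N) (P t)%:R * x ^+ points t.
  rewrite [RHS]big_mkcond; apply: eq_bigr => t _.
  by case: ltnP => // /expr_nilp->; rewrite mulr0.
rewrite /gf !small -big_filter -[RHS]big_filter; apply: perm_big.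
apply: uniq_perm; rewrite ?filter_uniq ?trees_uniq // => t.
rewrite !mem_filter; case: (ltnP (points t) N) => //= lt_tN.
by rewrite (mem_trees (ltnW lt_tN)) (mem_trees (leqW (ltnW lt_tN))).
Qed.

(** The splitting of trees by their left end. *)
Lemma gf_rec (P : pred tree) : gf P = (P Leaf)%:R + x * gf (fun r => P (Fix r))
  + x ^+ 2 * \sum_(q <- trees N) \sum_(r <- trees N)
       (P (Arch q r))%:R * (x ^+ points q * x ^+ points r).
Proof.
rewrite -gf_succ /= big_cons big_cat big_map big_allpairs_dep /= mulr1 addrA.
congr (_ + _ + _).
  by rewrite mulr_sumr; apply: eq_bigr => r _; rewrite exprS; ring.
rewrite mulr_sumr; apply: eq_bigr => q _; rewrite mulr_sumr; apply: eq_bigr => r _.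
by rewrite !exprS exprD; ring.
Qed.

Lemma gf_mul (P Q : pred tree) : gf P * gf Q = \sum_(q <- trees N) \sum_(r <- trees N)
  (P q && Q r)%:R * (x ^+ points q * x ^+ points r).
Proof.
rewrite /gf big_distrlr; apply: eq_bigr => q _; apply: eq_bigr => r _ /=.
by case: (P q); case: (Q r); rewrite /=; ring.
Qed.

Let sub_eq0 (a b : R) : a = b -> a - b = 0.
Proof. by move->; rewrite subrr. Qed.

(** The series D_m of the formulas at the top; [avoid2 k l] is L. *)
Definition short m : R := gf (fun t => (depth t < m)%N).

Definition avoid2 k l : R := gf (fun t => ~~ two_layers k l t).

Lemma eq_gf P Q : P =1 Q -> gf P = gf Q.
Proof. by move=> PQ; apply: eq_bigr => t _; rewrite PQ. Qed.

Lemma gf0 : gf (fun=> false) = 0.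
Proof. by rewrite /gf big1 // => t _; rewrite mul0r. Qed.

Lemma short0 : short 0 = 0. Proof. exact: gf0. Qed.

Lemma short1 : short 1 = 1.
Proof.
rewrite /short gf_rec (@eq_gf _ (fun=> false)) ?gf0.
  rewrite big1 => [|q _]; first by rewrite /=; ring.
  by rewrite big1 // => r _; rewrite gtn_max mul0r.
by move=> r; rewrite /= gtn_max.
Qed.

Lemma short_rec m : (1 - x) * short m.+2 = 1 + x ^+ 2 * short m * short m.+2.
Proof.
have -> : (1 - x) * short m.+2 = short m.+2 - x * short m.+2 by ring.
rewrite {1}/short gf_rec -mulrA gf_mul /=.
rewrite (@eq_gf (fun r => (maxn 1 (depth r) < m.+2)%N) (fun t => (depth t < m.+2)%N)).
  under eq_bigr do under eq_bigr do rewrite gtn_max !ltnS.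
  by rewrite /short; ring.
by move=> r; rewrite gtn_max.
Qed.

(** The addition law is stable under [k -> k + 2]: after elimination of
[1 / D_{m+2} = 1 - x - x^2 D_m] the new law is a multiple of the old one.  By
symmetry it remains to check it for [k, l <= 1]. *)
Lemma short_add k l :
  short (k + l) = short k + short l - (1 - x) * short k * short l
                  + x ^+ 2 * short k * short l * short (k + l).
Proof.
pose law i j := short (i + j)
  = short i + short j - (1 - x) * short i * short j
    + x ^+ 2 * short i * short j * short (i + j).
have law_sym i j : law i j -> law j i.
  by rewrite /law (addnC j) => E; rewrite {1}E; ring.
have law_step i j : law i j -> law i.+2 j.
  rewrite /law !addSn; have := short_rec i; have := short_rec (i + j).
  move: (short i) (short i.+2) (short j) (short (i + j)) (short (i + j).+2) => a a' b c c'.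
  move=> /sub_eq0 Ec /sub_eq0 Ea /sub_eq0 E; apply: subr0_eq.
  (* The cofactors come from c' - a' = a' c' (1/a' - 1/c') = x^2 a' c' (c - a). *)
  transitivity (x ^+ 2 * a' * c' *
      (c - (a + b - (1 - x) * a * b + x ^+ 2 * a * b * c))
    + (b - c') * ((1 - x) * a' - (1 + x ^+ 2 * a * a'))
    + (a' - x ^+ 2 * a * a' * b) * ((1 - x) * c' - (1 + x ^+ 2 * c * c'))).
    by ring.
  by rewrite E Ea Ec !mulr0 !addr0.
have law0 j : law 0 j by rewrite /law short0 add0n; ring.
have law11 : law 1 1.
  rewrite /law short1; have := short_rec 0; rewrite short0 => /sub_eq0 E; apply: subr0_eq.
  by transitivity ((1 + x) * ((1 - x) * short 2 - (1 + x ^+ 2 * 0 * short 2)));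
    [ring|rewrite E mulr0].
have law1 j : law 1 j /\ law 1 j.+1.
  elim: j => [|j [IHj IHj']]; first by split=> //; apply/law_sym/law0.
  by split=> //; apply/law_sym/law_step/law_sym.
have all_law i : law i l /\ law i.+1 l.
  elim: i => [|i [IHi IHi']]; first by split; [apply: law0|case: (law1 l)].
  by split=> //; apply: law_step.
by case: (all_law k).
Qed.

Lemma two_layers_depthl k l t : two_layers k l t -> (k <= depth t)%N.
Proof.
elim: t => //= [r IHr|q IHq r IHr].
  by case/orP=> [/IHr|/andP[]]; lia.
by case/or3P=> [/IHq|/IHr|/andP[]]; lia.
Qed.

Lemma two_layers_depthr k l t : two_layers k l t -> (l <= depth t)%N.
Proof.
elim: t => //= [r IHr|q IHq r IHr].
  by case/orP=> [/IHr|/andP[]]; lia.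
by case/or3P=> [/IHq|/IHr|/andP[]]; lia.
Qed.

(** For [k = k' + 2], an arch over [q] followed by [r] avoids [k,l] when [q] and [r]
do and moreover [depth q < k'] or [depth r < l]; each of these two conditions
alone forces avoidance in its own part, so inclusion-exclusion gives
  L = 1 + x L + x^2 (D_k' L + L D_l - D_k' D_l),
and multiplication by [D_k] leads to the equation stated.  For [k = 1] only the
condition [depth r < l] is left. *)
Lemma avoid2_rec k l : (0 < k)%N ->
  avoid2 k l = short k + short l - (1 - x) * short k * short l
               + x ^+ 2 * short k * short l * avoid2 k l.
Proof.
move: k => [//|[|k]] _.
  rewrite short1 {1}/avoid2 gf_rec /=.
  rewrite (@eq_gf _ (fun r => (depth r < l)%N)) => [|r]; last first.
    have := @two_layers_depthr 1 l r; rewrite ltnNge.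
    by case: (two_layers 1 l r) => [->|_] //=.
  have arch q r : ~~ [|| two_layers 1 l q, two_layers 1 l r | (l <= depth r)%N]
      = ~~ two_layers 1 l q && (depth r < l)%N.
    have := @two_layers_depthr 1 l r; rewrite ltnNge.
    by case: (two_layers 1 l q); case: (two_layers 1 l r) => [->|_].
  under eq_bigr do under eq_bigr do rewrite arch.
  rewrite -(gf_mul (fun q => ~~ two_layers 1 l q) (fun r => depth r < l)%N).
  by rewrite /avoid2 /short; ring.
have rec : avoid2 k.+2 l = 1 + x * avoid2 k.+2 l
  + x ^+ 2 * (short k * avoid2 k.+2 l + avoid2 k.+2 l * short l - short k * short l).
  rewrite {1}/avoid2 gf_rec /=.
  rewrite (@eq_gf _ (fun r => ~~ two_layers k.+2 l r)) => [|r]; last first.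
    by rewrite orbF.
  congr (_ + _ + _ * _); rewrite /short /avoid2 !gf_mul -big_split /= -sumrB.
  apply: eq_bigr => q _; rewrite -big_split /= -sumrB; apply: eq_bigr => r _.
  rewrite -mulrDl -mulrBl; congr (_ * _).
  have := @two_layers_depthl k.+2 l q; have := @two_layers_depthr k.+2 l r.
  rewrite !ltnS (ltnNge _ k) (ltnNge _ l).
  case: (two_layers k.+2 l r) => [/(_ isT)->|_]; case: (two_layers k.+2 l q).
  - by move/(_ isT)/ltnW/ltnW->; rewrite /= ?andbF; ring.
  - by move=> _; rewrite /= ?andbF; ring.
  - by move/(_ isT)/ltnW/ltnW->; rewrite /=; ring.
  by case: (k <= _)%N; case: (l <= _)%N => _ /=; ring.
have := short_rec k; move: rec.
move: (avoid2 _ _) (short k) (short k.+2) (short l) => u a a' b.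
move=> /sub_eq0 Eu /sub_eq0 Ea; apply: subr0_eq.
transitivity (a' * (u - (1 + x * u + x ^+ 2 * (a * u + u * b - a * b)))
  + (b - u) * ((1 - x) * a' - (1 + x ^+ 2 * a * a'))).
  by ring.
by rewrite Eu Ea !mulr0 addr0.
Qed.

(** The difference [d] satisfies [d = x^2 D_k D_l d], hence is divisible by every
power of [x]. *)
Lemma avoid2_short k l : (0 < k)%N -> avoid2 k l = short (k + l).
Proof.
move=> k_gt0; set y := x ^+ 2 * short k * short l.
have diff : avoid2 k l - short (k + l) = y * (avoid2 k l - short (k + l)).
  by rewrite {1}avoid2_rec // {1}short_add /y; ring.
have iterated n : avoid2 k l - short (k + l) = y ^+ n * (avoid2 k l - short (k + l)).
  by elim: n => [|n IHn]; rewrite ?mul1r // exprSr -mulrA -diff.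
have yN : y ^+ N = 0.
  by rewrite /y 2!exprMn exprAC xN expr0n !mul0r.
by apply: subr0_eq; rewrite (iterated N) yN mul0r.
Qed.

End GeneratingFunctions.

(** * Extraction of coefficients *)

Section Coefficients.

Import GRing.Theory.
Local Open Scope ring_scope.

Lemma coef_mod_Xn (p : {poly int}) n :
  (val (in_qpoly ('X^(n.+1)) p))`_n = p`_n.
Proof.
rewrite /= mk_monic_Xn /= [in RHS](Pdiv.RingMonic.rdivp_eq (monicXn _ n.+1) p).
by rewrite coefD coefMXn ltnSn add0r.
Qed.

(** Identities between truncated generating functions in Z[X]/(X^{n+1}) determine
the numbers of trees with [n] points. *)
Lemma count_eq_of_gf (P Q : pred tree) n :
  (forall (R : comNzRingType) (x : R), x ^+ n.+1 = 0 -> gf x n.+1 P = gf x n.+1 Q) ->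
  count (fun t => (points t == n) && P t) (trees n.+1)
    = count (fun t => (points t == n) && Q t) (trees n.+1).
Proof.
move=> eqPQ; pose h : {poly int} := 'X^(n.+1).
pose G (P' : pred tree) : {poly int} :=
  \sum_(t <- trees n.+1) (P' t)%:R * 'X^(points t).
have inG P' : in_qpoly h (G P') = gf (qpolyX h) n.+1 P'.
  rewrite /G rmorph_sum; apply: eq_bigr => t _.
  by rewrite rmorphM rmorph_nat rmorphXn.
have coefG P' : (G P')`_n
    = (count (fun t => (points t == n) && P' t) (trees n.+1))%:Z.
  rewrite /G coef_sum; elim: (trees n.+1) => [|t s IHs] /=; first by rewrite big_nil.
  rewrite big_cons IHs PoszD; congr (_ + _).
  by rewrite mulr_natl coefMn coefXn eq_sym; case: (P' t); case: eqP.
have xN : qpolyX h ^+ n.+1 = 0.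
  rewrite -rmorphXn; apply: val_inj; rewrite /= mk_monic_Xn.
  exact: (Pdiv.RingMonic.rmodpp (monicXn _ _)).
have := congr1 (fun u : {poly %/ h} => (val u)`_n) (eqPQ _ _ xN).
by rewrite -!inG !coef_mod_Xn !coefG => -[].
Qed.

End Coefficients.

Theorem theorem6p8 (k l : nat) (hk : 1 <= k) (hl : 1 <= l) :
  F (layered k l) = F (decreasing (k + l)).
Proof.
apply: functional_extensionality => n; congr Posz.
rewrite (@card_avoiding_involutions n _ (fun t => ~~ two_layers k l t) n.+1) //; last first.
  by move=> t; rewrite negbK; apply: (iffP idP) => [|/occurs_layered/two_decr_word];
    [move=> ?; apply/occurs_layered/two_decr_word|apply].
rewrite (@card_avoiding_involutions n _ (fun t => depth t < k + l) n.+1) //; last first.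
  by move=> t; rewrite -leqNgt; apply: (iffP idP) => [|/occurs_decreasing/decr_word//] ?;
    apply/occurs_decreasing/decr_word.
by apply: count_eq_of_gf => // R x xN; apply: avoid2_short.
Qed.
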